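(* Let $\phi(x)=\sum_{n=0}^\infty \alpha_n x^n$ be a formal power series with real coefficients, and write $\phi^{(n)}(0)=n!\,\alpha_n$. Suppose that $\phi(0)\neq 0$, that $\phi''(0)\phi(0)-\phi'(0)^2\ge 0$, and that $\phi$ is not of the form $\phi(x)=ce^{\gamma x}$ with $c\ne 0$. Let $f$ be a real polynomial with $$\deg f\ \ge\ \min\{n\ge 2 : \phi^{(n)}(0)\phi(0)^{n-1}-\phi'(0)^n\neq 0\}.$$ Then there is a positive integer $m_0$ such that $Z_C(\phi(D)^m f)>0$ for all $m\ge m_0$.
   Context: $D$ denotes differentiation. For a formal power series $\phi(x)=\sum\alpha_n x^n$ (not assumed convergent) and a polynomial $f$, $\phi(D)f=\sum_{n\ge 0}\alpha_n f^{(n)}$ (a finite sum), and $\phi(D)^m f$ denotes the $m$-fold application of $\phi(D)$ to $f$. For a real polynomial (or real entire function) $g$, $Z_C(g)$ denotes the number of nonreal zeros of $g$ counted with multiplicity, with $Z_C(g)=0$ if $g$ is identically $0$. *)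

(* Defs.v *)
From HB Require Import structures.
From mathcomp Require Import all_boot all_order all_algebra.
From mathcomp Require Import complex.
From mathcomp Require Import boolp reals.

Set Implicit Arguments.
Unset Strict Implicit.
Unset Printing Implicit Defensive.

Import Order.TTheory GRing.Theory Num.Theory.
Local Open Scope ring_scope.

(* A formal power series phi = \sum_n alpha_n x^n is given by its coefficient
   sequence [alpha : nat -> R]. *)

(* phi^(n)(0) = n! alpha_n *)
Definition fps_deriv0 (R : realType) (alpha : nat -> R) (n : nat) : R :=
  alpha n *+ n`!.

(* phi(D) f; the sum may stop at [size f] since f^`(n) = 0 for n >= size f. *)
Definition fps_D (R : realType) (alpha : nat -> R) (f : {poly R}) : {poly R} :=
  \sum_(n < size f) alpha n *: f^`(n).

(* phi(x) = c e^(gamma x) with c != 0, as formal power series *)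
Definition is_exponential (R : realType) (alpha : nat -> R) : Prop :=
  exists c gamma : R,
    c != 0 /\ forall n : nat, alpha n = c * gamma ^+ n / (n`!)%:R.

(* The complex zeros of g, each repeated according to its multiplicity:
   g = lead_coef g *: \prod_(z <- complex_zeros g) ('X - z%:P).
   Only meaningful for g != 0. *)
Definition complex_zeros (R : realType) (g : {poly R}) : seq (complex R) :=
  sval (closed_field_poly_normal (map_poly (real_complex R) g)).

Definition ZC (R : realType) (g : {poly R}) : nat :=
  if g == 0 then 0%N
  else count (fun z : complex R => complex.Im z != 0) (complex_zeros g).

Definition deviates_at (R : realType) (alpha : nat -> R) (n : nat) : bool :=
  fps_deriv0 alpha n * fps_deriv0 alpha 0 ^+ n.-1 - fps_deriv0 alpha 1 ^+ n
    != 0.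

(* N = min {n >= 2 : phi^(n)(0) phi(0)^(n-1) - phi'(0)^n != 0} *)
Definition is_first_deviation (R : realType) (alpha : nat -> R) (N : nat)
    : Prop :=
  [/\ (2 <= N)%N, deviates_at alpha N &
      forall n : nat, (2 <= n)%N -> deviates_at alpha n -> (N <= n)%N].

(* The minimum above is taken over a nonempty set. *)
Lemma first_deviation_exists (R : realType) (alpha : nat -> R) :
  fps_deriv0 alpha 0 != 0 -> ~ is_exponential alpha ->
  exists N : nat, is_first_deviation alpha N.
Proof.
move=> a0 nexp.
have ex : exists n, (2 <= n)%N && deviates_at alpha n.
  apply: contrapT => nex; apply: nexp.
  exists (fps_deriv0 alpha 0), (fps_deriv0 alpha 1 / fps_deriv0 alpha 0).
  split=> // n.
  have nf : (n`!)%:R != 0 :> R by rewrite pnatr_eq0 -lt0n fact_gt0.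
  apply: (mulIf nf); rewrite mulfVK // mulr_natr -/(fps_deriv0 alpha n).
  case: n nf => [|[|n]] _; first by rewrite expr0 mulr1.
    by rewrite expr1 mulrCA divff // mulr1.
  have [|/negbNE] := boolP (deviates_at alpha n.+2).
    by move=> d; case: nex; exists n.+2.
  rewrite subr_eq0 => /eqP e.
  apply: (mulIf (expf_neq0 n.+1 a0)).
  by rewrite e mulrAC -exprS -exprMn mulrC divfK.
case: (ex_minnP ex) => N /andP[N2 dN] minN; exists N; split=> // n n2 dn.
by apply: minN; rewrite n2.
Qed.

(* Main.v *)
Require Import Defs.
From mathcomp Require Import all_boot all_order all_algebra.
From mathcomp Require Import complex.
From mathcomp Require Import boolp reals.
From mathcomp Require Import ring lra zify.

(* Write a_n for phi^(n)(0) and put gamma = a_1 / a_0. By Taylor's formula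
   phi(D) / a_0 is the translation e^(gamma D) plus an operator of order N, so
   phi(D)^m f = a_0^m g_m(x + m gamma), where g_m agrees with f in degrees
   above d - N (d = deg f) and the coefficient of g_m in degree d - N is that of
   f plus m B with B <> 0. The squares of the zeros of g_m sum to
   S = (g_{d-1}^2 - 2 g_d g_{d-2}) / g_d^2. If N = 2 then a_2 a_0 - a_1^2 > 0
   drives S to -oo, which is impossible for real zeros. If N > 2 then S does not
   depend on m, so real zeros, and hence all coefficients of g_m, would stay
   bounded, whereas the coefficient in degree d - N does not. *)

Import Order.TTheory GRing.Theory Num.Theory.
Local Open Scope ring_scope.

(** * Translation of polynomials as the operator e^(cD) *)

Lemma comp_polyXaddC_taylor (R : comNzRingType) (p : {poly R}) (c : R) :
  p \Po ('X + c%:P) = \sum_(n < size p) c ^+ n *: p^`N(n).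
Proof.
rewrite comp_polyE.
(* With coefficients lifted to constant polynomials, translation is evaluation at ['X + c%:P], to
   which Taylor's formula applies. *)
have -> : \sum_(i < size p) p`_i *: ('X + c%:P) ^+ i = (p^:P).['X + c%:P].
  rewrite horner_poly; apply: eq_bigr => i _.
  by rewrite mul_polyC.
rewrite (@nderiv_taylor_wide _ (size p)); last first.
- by rewrite size_map_polyC.
- exact: mulrC.
apply: eq_bigr => i _.
rewrite nderivn_map -[X in X * _]/(comp_poly 'X p^`N(i)) comp_polyXr.
by rewrite -polyC_exp mulrC mul_polyC.
Qed.

Lemma coef_comp_polyXaddC (R : comNzRingType) (p : {poly R}) (c : R) k :
  (size p <= k.+1)%N -> (p \Po ('X + c%:P))`_k = p`_k.
Proof.
move=> sp; rewrite comp_polyXaddC_taylor coef_sum.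
case: (posnP (size p)) => [s0|s0].
  by rewrite s0 big_ord0 nth_default ?s0.
rewrite (bigD1 (Ordinal s0)) //= coefZ coef_nderivn bin0 expr0 mul1r mulr1n.
rewrite big1 ?addr0 // => i; rewrite -val_eqE /= -lt0n => i0.
rewrite coefZ coef_nderivn nth_default ?mul0rn ?mulr0 //.
by rewrite (leq_trans sp) // -add1n leq_add2r.
Qed.

Lemma fps_D_deriv0 (R : realType) (alpha : nat -> R) (p : {poly R}) :
  fps_D alpha p = \sum_(n < size p) fps_deriv0 alpha n *: p^`N(n).
Proof.
apply: eq_bigr => n _.
by rewrite nderivn_def /fps_deriv0 -scalerMnl scalerMnr.
Qed.

(** * Zeros and coefficients of real-rooted polynomials *)

(* The factor 'X^2 makes the two coefficients exist also when [size s < 2]. *)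
Lemma prod_XsubC_newton (R : comNzRingType) (s : seq R) :
  let p := 'X^2 * \prod_(y <- s) ('X - y%:P) in
  [/\ p`_(size s).+2 = 1, p`_(size s).+1 = - \sum_(y <- s) y &
      p`_(size s) *+ 2 = (\sum_(y <- s) y) ^+ 2 - \sum_(y <- s) y ^+ 2].
Proof.
elim: s => [|y s [h2 h1 h0]] /=.
  by rewrite !big_nil mulr1 !coefXn /= oppr0 mul0rn addr0 expr0n.
rewrite !big_cons mulrCA; set p := 'X^2 * _ in h0 h1 h2 *.
have E k : (('X - y%:P) * p)`_k.+1 = p`_k - y * p`_k.+1.
  by rewrite mulrBl coefB coefXM coefCM.
rewrite !E h2 h1; split.
- rewrite nth_default ?mulr0 ?subr0 // /p mulrC size_mulXn; last first.
    exact/monic_neq0/monic_prod_XsubC.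
  by rewrite size_prod_XsubC.
- by rewrite mulr1 opprD addrC.
- rewrite mulrnBl h0; ring.
Qed.

(** A factor ['X - y%:P] turns each coefficient into one old coefficient minus [y] times another, so
    the bound grows by at most [1 + M]. *)
Lemma prod_XsubC_coef_le (R : numDomainType) (M : R) (s : seq R) k :
  (forall y, y \in s -> `|y| <= M) ->
  `|(\prod_(y <- s) ('X - y%:P))`_k| <= (1 + M) ^+ size s.
Proof.
elim: s k => [|y s IH] k hM.
  by rewrite big_nil coef1 expr0; case: eqP; rewrite ?normr1 ?normr0.
have yM : `|y| <= M by apply: hM; rewrite mem_head.
have M0 : 0 <= M by apply: le_trans yM.
have {}IH j : `|(\prod_(y <- s) ('X - y%:P))`_j| <= (1 + M) ^+ size s.
  by apply: IH => z zs; apply: hM; rewrite inE zs orbT.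
rewrite big_cons mulrBl coefB coefXM coefCM /= exprS mulrDl mul1r.
apply: (le_trans (ler_normB _ _)); apply: lerD.
  by case: eqP => _; rewrite // normr0 exprn_ge0 // addr_ge0.
by rewrite normrM ler_pM.
Qed.

Lemma ZC0_split (R : realType) (h : {poly R}) :
  h != 0 -> ZC h = 0%N ->
  exists s : seq R, h = lead_coef h *: \prod_(y <- s) ('X - y%:P).
Proof.
rewrite /ZC => /negPf h0; rewrite h0 /complex_zeros.
case: closed_field_poly_normal => /= z hz /eqP.
rewrite -leqn0 leqNgt -has_count -all_predC => /allP zr.
exists (map (@complex.Re R) z).
apply: (@map_poly_inj _ _ (real_complex R)).
rewrite hz lead_coef_map map_polyZ /= big_map rmorph_prod /=; congr (_ *: _).
apply: eq_big_seq => w wz; rewrite rmorphB /= map_polyX map_polyC /=.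
congr (_ - _%:P); move: (zr w wz) => /=; rewrite negbK.
by case: w {wz} => a b /= /eqP ->.
Qed.

Lemma prod_XsubC_comp_XsubC (R : comNzRingType) (s : seq R) (c : R) :
  (\prod_(y <- s) ('X - y%:P)) \Po ('X - c%:P) =
  \prod_(y <- [seq y + c | y <- s]) ('X - y%:P).
Proof.
rewrite big_map rmorph_prod /=; apply: eq_bigr => y _.
by rewrite comp_polyB comp_polyX comp_polyC polyCD -addrA -opprD [c%:P + _]addrC.
Qed.

Lemma ZC0_shift_split (R : realType) (g : {poly R}) (k c : R) :
  k != 0 -> g != 0 -> ZC (k *: (g \Po ('X + c%:P))) = 0%N ->
  exists s : seq R, g = lead_coef g *: \prod_(y <- s) ('X - y%:P).
Proof.
move=> k0 g0 /ZC0_split [|s hs].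
  by rewrite scaler_eq0 (negPf k0) comp_poly2_eq0 ?size_XaddC.
exists [seq y + c | y <- s]; rewrite -prod_XsubC_comp_XsubC.
apply: (scalerI k0); rewrite scalerA -comp_polyZ.
have -> : lead_coef g = lead_coef (g \Po ('X + c%:P)).
  by rewrite lead_coef_comp ?size_XaddC // lead_coefXaddC expr1n mulr1.
rewrite -lead_coefZ -hs comp_polyZ -comp_polyA comp_polyD comp_polyX comp_polyC.
by rewrite subrK comp_polyXr.
Qed.

(** By Newton's identity, [D] over the squared leading coefficient is the sum of the squares of the
    zeros. This bounds every zero, hence every coefficient. *)
Lemma real_rooted_coef_bound (R : realFieldType) (g : {poly R}) (s : seq R) d :
  g = lead_coef g *: \prod_(y <- s) ('X - y%:P) -> size g = d.+3 ->
  let D := g`_d.+1 ^+ 2 - g`_d.+2 * g`_d *+ 2 in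
  0 <= D /\
  forall j, `|g`_j| <= `|g`_d.+2| * (1 + (1 + D / g`_d.+2 ^+ 2)) ^+ d.+2.
Proof.
move=> hg sg D; set k := g`_d.+2 in D *.
have kE : lead_coef g = k by rewrite lead_coefE sg.
have k0 : k != 0 by rewrite -kE lead_coef_eq0 -size_poly_gt0 sg.
have ss : size s = d.+2.
  by move: sg; rewrite hg size_scale ?kE // size_prod_XsubC => -[].
rewrite kE in hg.
have := prod_XsubC_newton _ s; rewrite ss => -[].
have E j : ('X^2 * \prod_(y <- s) ('X - y%:P))`_j.+2 = k^-1 * g`_j.
  by rewrite hg coefXnM coefZ mulKf // !subSS subn0.
rewrite !E => _ e1 e2.
have DE : D / k ^+ 2 = \sum_(y <- s) y ^+ 2.
  have -> : \sum_(y <- s) y ^+ 2 =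
      (\sum_(y <- s) y) ^+ 2 - (k^-1 * g`_d) *+ 2 by rewrite e2; ring.
  by rewrite -[(\sum_(y <- s) y) ^+ 2]sqrrN -e1 /D; field.
have S0 : 0 <= \sum_(y <- s) y ^+ 2 by apply: sumr_ge0 => y _; exact: sqr_ge0.
split.
  rewrite -(pmulr_lge0 _ (_ : 0 < (k ^+ 2)^-1)) ?DE //.
  by rewrite invr_gt0 exprn_even_gt0.
move=> j; rewrite {1}hg coefZ normrM ler_wpM2l // -ss.
apply: prod_XsubC_coef_le => y ys.
have : y ^+ 2 <= D / k ^+ 2.
  rewrite DE (big_rem y ys) /= lerDl.
  by apply: sumr_ge0 => z _; exact: sqr_ge0.
(* This weaker bound avoids a square root. *)
have : `|y| <= 1 + y ^+ 2 by rewrite -real_normK ?num_real //; nra.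
lra.
Qed.

(** * Iterates of phi(D) up to translation *)

Section FirstDeviation.

Variables (R : realType) (alpha : nat -> R) (N : nat).
Hypothesis phi0 : fps_deriv0 alpha 0 != 0.
Hypothesis N_min : is_first_deviation alpha N.

Let a := fps_deriv0 alpha.
Let gamma := a 1%N / a 0%N.
(** This is N! times the first nonzero coefficient of phi(x) / phi(0) - e^(gamma x). *)
Let b := a N / a 0%N - gamma ^+ N.

Lemma deviation_eq n : (0 < n)%N ->
  a n * a 0%N ^+ n.-1 - a 1%N ^+ n = a 0%N ^+ n * (a n / a 0%N - gamma ^+ n).
Proof.
case: n => // n _; rewrite mulrBr -exprMn [a 0%N * gamma]mulrC divfK //.
by rewrite [a 0%N ^+ n.+1]exprSr -mulrA [a 0%N * _]mulrC divfK // mulrC.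
Qed.

Lemma deviation_neq0 : b != 0.
Proof.
case: N_min => N2; rewrite /deviates_at -/a deviation_eq ?(ltnW N2) //.
by rewrite mulf_eq0 negb_or => /andP[].
Qed.

Lemma deriv0_lt_deviation n : (n < N)%N -> a n = a 0%N * gamma ^+ n.
Proof.
case: n => [|[|n]] nN; first by rewrite expr0 mulr1.
  by rewrite expr1 mulrC divfK.
have [_ _ /(_ n.+2 isT)] := N_min.
rewrite leqNgt nN => /contraFN /(_ erefl) /negbNE.
rewrite -/a deviation_eq // mulf_eq0 expf_eq0 (negPf phi0) andbF /=.
by rewrite subr_eq0 => /eqP <-; rewrite mulrC divfK.
Qed.

(** In phi(D) / phi(0) - e^(gamma D) the orders below [N] cancel, and only the term of order [N]
    reaches degree [d - N]. *)
Lemma fps_D_shift (p : {poly R}) (d : nat) :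
  (size p <= d.+1)%N -> (N <= d)%N ->
  exists q : {poly R},
    [/\ fps_D alpha p = a 0%N *: (p \Po ('X + gamma%:P) + q),
        (size q <= (d - N).+1)%N &
        q`_(d - N) = b * p`_d *+ 'C(d, N)].
Proof.
move=> sp Nd.
have z n k : (N <= n)%N -> (d - N < k + (n - N))%N -> p^`N(n)`_k = 0.
  move=> Nn kd; rewrite coef_nderivn nth_default ?mul0rn //.
  by apply: leq_trans sp _; lia.
exists (\sum_(n < size p) (a n / a 0%N - gamma ^+ n) *: p^`N(n)).
have lo n : (n < N)%N -> a n / a 0%N - gamma ^+ n = 0.
  by move=> /deriv0_lt_deviation ->; rewrite mulrAC divff // mul1r subrr.
split.
- rewrite fps_D_deriv0 comp_polyXaddC_taylor -big_split scaler_sumr /=.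
  apply: eq_bigr => n _; rewrite -scalerDl scalerA; congr (_ *: _).
  by rewrite addrC subrK mulrC divfK.
- apply/leq_sizeP => k kd; rewrite coef_sum big1 // => n _; rewrite coefZ.
  have [/lo ->|Nn] := ltnP n N; first by rewrite mul0r.
  by rewrite z ?mulr0 // ltn_addr.
(* If [size p <= N], the sum has no term of order [N], but then the coefficient of [p] in degree [d]
   vanishes too. *)
- rewrite coef_sum; have [Np|pN] := ltnP N (size p); last first.
    rewrite (@nth_default _ _ p) ?mulr0 ?mul0rn ?(leq_trans pN) //.
    rewrite big1 // => n _; rewrite coefZ lo ?mul0r //.
    exact: leq_trans (ltn_ord n) pN.
  rewrite (bigD1 (Ordinal Np)) //= big1 ?addr0 => [|n].
    by rewrite coefZ coef_nderivn subnKC // mulrnAr.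
  rewrite -val_eqE /= coefZ => nN.
  have [/lo ->|Nn] := ltnP n N; first by rewrite mul0r.
  by rewrite z ?mulr0 //; lia.
Qed.

(** Each step corrects [g] in degrees at most [d - N] only. Its coefficient in degree [d] stays
    fixed, so the increment in degree [d - N] is the same every time. *)
Lemma iter_fps_D_shift (f : {poly R}) (d m : nat) :
  (size f <= d.+1)%N -> (N <= d)%N ->
  exists g : {poly R},
    [/\ iter m (fps_D alpha) f
          = a 0%N ^+ m *: (g \Po ('X + (gamma *+ m)%:P)),
        (size (g - f)%R <= (d - N).+1)%N &
        g`_(d - N) = f`_(d - N) + b * f`_d *+ 'C(d, N) *+ m].
Proof.
move=> sf Nd; elim: m => [|m [g [hg sg cg]]].
  exists f; rewrite expr0 scale1r mulr0n addr0 comp_polyXr subrr size_poly0.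
  by rewrite mulr0n addr0.
have [N2 _ _] := N_min.
have gd : g`_d = f`_d.
  apply/eqP; rewrite -subr_eq0 -coefB nth_default //.
  by apply: leq_trans sg _; lia.
have sgd : (size g <= d.+1)%N.
  rewrite -[g](subrK f) (leq_trans (size_polyD _ _)) // geq_max sf andbT.
  by apply: leq_trans sg _; lia.
have ssh (p : {poly R}) c : size (p \Po ('X + c%:P)) = size p.
  by rewrite size_comp_poly2 // size_XaddC.
set p := a 0%N ^+ m *: (g \Po ('X + (gamma *+ m)%:P)).
have sp : (size p <= d.+1)%N by rewrite (leq_trans (size_scale_leq _ _)) // ssh.
have [q [hq sq cq]] := fps_D_shift p d sp Nd.
have am0 : a 0%N ^+ m != 0 by rewrite expf_neq0.
(* The correction [q] is translated back and rescaled, so that the common translation and factor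
   restore it. *)
exists (g + (a 0%N ^+ m)^-1 *: (q \Po ('X + (- (gamma *+ m.+1))%:P))); split.
- rewrite iterS hg hq exprS -scalerA; congr (_ *: _).
  rewrite comp_polyD scalerDr !comp_polyZ scalerA mulfV // scale1r -!comp_polyA.
  rewrite !(comp_polyD, comp_polyX, comp_polyC) -!addrA -!polyCD subrr addr0.
  by rewrite comp_polyXr mulrS.
- rewrite addrAC (leq_trans (size_polyD _ _)) // geq_max sg /=.
  by rewrite (leq_trans (size_scale_leq _ _)) // ssh.
- rewrite coefD cg coefZ coef_comp_polyXaddC // cq coefZ.
  rewrite coef_comp_polyXaddC // gd mulrnAr mulrCA mulKf //.
  by rewrite -addrA -mulrSr.
Qed.

End FirstDeviation.

(** * Nonreal zeros for large [m]: the cases N = 2 and N > 2 *)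

Theorem theorem1p2 (R : realType) (alpha : nat -> R)
    (phi0 : fps_deriv0 alpha 0 != 0)
    (phi2 : 0 <= fps_deriv0 alpha 2 * fps_deriv0 alpha 0
                 - fps_deriv0 alpha 1 ^+ 2)
    (phi_nexp : ~ is_exponential alpha)
    (f : {poly R}) (N : nat) (N_min : is_first_deviation alpha N)
    (* the degree of f is (size f).-1; as N >= 2, this excludes f = 0 *)
    (deg_f : (N <= (size f).-1)%N) :
  exists m0 : nat, (0 < m0)%N /\
    forall m : nat, (m0 <= m)%N -> (0 < ZC (iter m (fps_D alpha) f))%N.
Proof.
have [N2 _ _] := N_min.
have b0 := deviation_neq0 _ _ _ phi0 N_min.
have [d dE] : exists d, size f = d.+3.
  by case: (size f) deg_f => [|[|[|d]]]; [lia|lia|lia|exists d].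
rewrite dE /= in deg_f.
have fd : f`_d.+2 != 0.
  by rewrite -[d.+2]/(d.+3.-1) -dE lead_coef_eq0 -size_poly_gt0 dE.
set b := (X in X != 0) in b0.
set B := b * f`_d.+2 *+ 'C(d.+2, N).
have C0 : (0 < 'C(d.+2, N)%:R :> R) by rewrite ltr0n bin_gt0.
have B0 : B != 0 by rewrite /B -mulr_natr !mulf_neq0 // gt_eqF.
have shift := iter_fps_D_shift R alpha N phi0 N_min f d.+2.
(* Agreement in degree [d] is assumed only for N > 2: when N = 2, this is the degree whose
   coefficient moves with [m]. *)
suff [T hT] : exists T : R, forall (m : nat) (g : {poly R}) (s : seq R),
    T < m%:R -> size g = d.+3 -> g`_d.+2 = f`_d.+2 -> g`_d.+1 = f`_d.+1 ->
    ((2 < N)%N -> g`_d = f`_d) ->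
    g`_(d.+2 - N) = f`_(d.+2 - N) + B *+ m ->
    ~ g = lead_coef g *: \prod_(y <- s) ('X - y%:P).
  exists (Num.bound `|T|).+1; split=> // m mT; rewrite lt0n; apply/eqP => Z.
  have [||g [hg sg cg]] := shift m; [by rewrite dE|by []|].
  have gf j : (d.+2 - N < j)%N -> g`_j = f`_j.
    move=> hj; apply/eqP; rewrite -subr_eq0 -coefB.
    by rewrite nth_default // (leq_trans sg).
  have g2 : g`_d.+2 = f`_d.+2 by apply: gf; lia.
  have sz : size g = d.+3.
    apply/eqP; rewrite eqn_leq; apply/andP; split; last first.
      by rewrite ltnNge; apply: contraNN fd => sd; rewrite -g2 nth_default.
    by apply/leq_sizeP => j hj; rewrite gf ?nth_default ?dE //; lia.
  move: Z; rewrite hg => /ZC0_shift_split[||s]; first by rewrite expf_neq0.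
    by rewrite -size_poly_gt0 sz.
  apply: (hT m) => //.
  - apply: le_lt_trans (ler_norm _) _.
    apply: lt_le_trans (archi_boundP (normr_ge0 _)) _.
    by rewrite ler_nat ltnW.
  - by apply: gf; lia.
  - by move=> N3; apply: gf; lia.
pose D := f`_d.+1 ^+ 2 - f`_d.+2 * f`_d *+ 2.
have [N3|] := ltnP 2 N; last first.
  move=> N2'; have NE : N = 2%N by apply/eqP; rewrite eqn_leq N2'.
  (* For N = 2, [phi2] says that phi(0)^2 [b] is nonnegative. *)
  have bp : 0 < b.
    rewrite lt0r b0 -(pmulr_rge0 _ (_ : 0 < fps_deriv0 alpha 0 ^+ 2)).
      by rewrite /b NE -deviation_eq // expr1.
    by rewrite exprn_even_gt0.
  (* The sign of [B] is unknown, but this product contains the square of the leading coefficient of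
     [f]. *)
  have P0 : 0 < f`_d.+2 * B *+ 2.
    rewrite pmulrn_lgt0 // /B -mulr_natr mulrA pmulr_lgt0 // mulrCA -expr2.
    by rewrite pmulr_rgt0 // exprn_even_gt0.
  (* For [g], the sum of squares has numerator [D] minus [m] times this denominator, negative beyond
     the threshold. *)
  exists (D / (f`_d.+2 * B *+ 2)) => m g s.
  rewrite ltr_pdivrMr // => mT sg g2 g1 _.
  rewrite NE subSS subSS subn0 => gd /real_rooted_coef_bound /(_ sg) [+ _].
  apply/negP; rewrite -ltNge g2 g1 gd -mulr_natr.
  by move: mT; rewrite /D; lra.
pose K := `|f`_d.+2| * (1 + (1 + D / f`_d.+2 ^+ 2)) ^+ d.+2.
(* Beyond this threshold the triangle inequality pushes the moving coefficient above [K], which does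
   not depend on [m]. *)
exists ((`|f`_(d.+2 - N)| + K) / `|B|) => m g s.
rewrite ltr_pdivrMr ?normr_gt0 // => mT sg g2 g1 /(_ isT) gd gN.
move=> /real_rooted_coef_bound /(_ sg) [_ /(_ (d.+2 - N)%N)].
apply/negP; rewrite -ltNge g2 g1 gd -/D -/K gN.
rewrite -(ltrD2l `|f`_(d.+2 - N)|) (lt_le_trans mT) //.
rewrite -normr_nat -normrM mulr_natl -{1}[B *+ m](addKr f`_(d.+2 - N)).
by rewrite (le_trans (ler_normD _ _)) ?normrN.
Qed.
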